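(* Let $0<\alpha<1$, $\rho\ge0$, $D>0$, $l>0$, $T>0$, $r\ge1$. For all positive integers $M\geq 2$, $N$ (with no restriction relating the spatial step to the temporal steps), let $(u_i^n)$ be the solution of the scheme $${}_0^C\mathbb{D}_t^{(\alpha,\rho)}u_i^n=D\,\delta_x^2u_i^n+f_i^n,\quad 1\le i\le M-1,\ 1\le n\le N,$$ $$u_0^n=u_M^n=0\ \ (0<n\le N),\qquad u_i^0=\psi(x_i)\ \ (0\le i\le M).$$ Then the scheme is unconditionally stable, in the sense that for every $n=1,\dots,N$ $$\|u^n\|_\infty\le\|u^0\|_\infty+\tau_n^\alpha\,\Gamma(2-\alpha)\sum_{j=1}^n\theta_{n,j}\|f^j\|_\infty ,$$ where $\theta_{n,n}=1$ and, for $1\le j\le n-1$, $\theta_{n,j}=\sum_{k=1}^{n-j}\tau_{n-k}^{\alpha}(d_{n,k}-d_{n,k+1})\,\theta_{n-k,j}$.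
   Context: Mesh: $h=l/M$, $x_i=ih$ for $0\le i\le M$; $t_n=T(n/N)^r$ for $0\le n\le N$; $\tau_n=t_n-t_{n-1}$ for $1\le n\le N$. The data are a function $\psi:[0,l]\to\mathbb{R}$ and a source $f$, with $f_i^n=f(x_i,t_n)$. Discrete operators: $\delta_x^2u_i^n=(u_{i-1}^n-2u_i^n+u_{i+1}^n)/h^2$, and the tempered L1 operator $${}_0^C\mathbb{D}_t^{(\alpha,\rho)}u_i^n=\frac{1}{\Gamma(2-\alpha)}\sum_{k=0}^{n-1}\frac{e^{-\rho(t_n-t_{k+1})}u_i^{k+1}-e^{-\rho(t_n-t_k)}u_i^k}{\tau_{k+1}}\left[(t_n-t_k)^{1-\alpha}-(t_n-t_{k+1})^{1-\alpha}\right].$$ For $1\le k\le n$ the coefficients are $$d_{n,k}=\frac{(t_n-t_{n-k})^{1-\alpha}-(t_n-t_{n-k+1})^{1-\alpha}}{\tau_{n-k+1}}.$$ Norms: $\|u^n\|_\infty=\max_{0\le i\le M}|u_i^n|$ and $\|f^j\|_\infty=\max_{1\le i\le M-1}|f_i^j|$. *)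

(* Defs.v *)
From HB Require Import structures.
From mathcomp Require Import all_boot all_order all_algebra.
From mathcomp Require Import all_classical all_reals all_analysis.
From mathcomp Require Import zify.
Set Implicit Arguments.
Unset Strict Implicit.
Unset Printing Implicit Defensive.
Import Order.TTheory GRing.Theory Num.Theory.
Import numFieldNormedType.Exports.
Local Open Scope classical_set_scope.
Local Open Scope ring_scope.

(* Euler's integral as a real-valued Lebesgue integral (meaningful for z > 0). *)
Definition Gamma (R : realType) (z : R) : R :=
  \int[@lebesgue_measure R]_(x in `]0, +oo[) (x `^ (z - 1) * expR (- x)).

(* Grid functions are total on nat * nat, with the space index first: u i n
   stands for u_i^n. Only the values with i <= M and n <= N are ever used. *)

Definition space_step (R : realType) (l : R) (M : nat) : R := l / M%:R.

Definition space_node (R : realType) (l : R) (M i : nat) : R :=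
  i%:R * space_step l M.

Definition time_node (R : realType) (T r : R) (N n : nat) : R :=
  T * (n%:R / N%:R) `^ r.

(* The operators below take an arbitrary sequence t of time nodes. *)
Definition tau (R : realType) (t : nat -> R) (n : nat) : R := t n - t n.-1.

Definition delta2 (R : realType) (h : R) (u : nat -> nat -> R) (i n : nat) : R :=
  (u i.-1 n - 2 * u i n + u i.+1 n) / h ^+ 2.

Definition tempered_L1 (R : realType) (alpha rho : R) (t : nat -> R)
    (u : nat -> nat -> R) (i n : nat) : R :=
  (Gamma (2 - alpha))^-1 *
  \sum_(0 <= k < n)
    (expR (- rho * (t n - t k.+1)) * u i k.+1
       - expR (- rho * (t n - t k)) * u i k) / tau t k.+1
    * ((t n - t k) `^ (1 - alpha) - (t n - t k.+1) `^ (1 - alpha)).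

Definition L1_coef (R : realType) (alpha : R) (t : nat -> R) (n k : nat) : R :=
  ((t n - t (n - k)%N) `^ (1 - alpha) - (t n - t (n - k).+1) `^ (1 - alpha))
    / tau t (n - k).+1.

(* theta_{n,j} is defined by recursion on a bound m >= n - j; it satisfies the
   expected equations by theta_diag and theta_rec, and is relevant for
   1 <= j <= n only. *)
Fixpoint theta_upto (R : realType) (alpha : R) (t : nat -> R) (m n j : nat) : R :=
  if m is m'.+1 then
    if n == j then 1 else
    \sum_(1 <= k < (n - j).+1)
      tau t (n - k)%N `^ alpha
      * (L1_coef alpha t n k - L1_coef alpha t n k.+1)
      * theta_upto alpha t m' (n - k)%N j
  else 1.

Definition theta (R : realType) (alpha : R) (t : nat -> R) (n j : nat) : R :=
  theta_upto alpha t (n - j) n j.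

Lemma theta_diag (R : realType) (alpha : R) (t : nat -> R) (n : nat) :
  theta alpha t n n = 1.
Proof. by rewrite /theta subnn. Qed.

Lemma theta_upto_stable (R : realType) (alpha : R) (t : nat -> R) (m n j : nat) :
  (j <= n)%N -> (n - j <= m)%N -> theta_upto alpha t m n j = theta alpha t n j.
Proof.
have H m1 m2 n' : (j <= n')%N -> (n' - j <= m1)%N -> (n' - j <= m2)%N ->
    theta_upto alpha t m1 n' j = theta_upto alpha t m2 n' j.
  elim: m1 m2 n' => [|m1 IH] [|m2] n' jn h1 h2 //=.
  - by have -> : n' == j by lia.
  - by have -> : n' == j by lia.
  case: eqP => // neq; apply: eq_big_nat => k /andP[k1 k2]; congr (_ * _).
  by apply: IH; lia.
by move=> jn hm; apply: H.
Qed.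

Lemma theta_rec (R : realType) (alpha : R) (t : nat -> R) (n j : nat) :
  (j < n)%N ->
  theta alpha t n j =
  \sum_(1 <= k < (n - j).+1)
    tau t (n - k)%N `^ alpha
    * (L1_coef alpha t n k - L1_coef alpha t n k.+1)
    * theta alpha t (n - k)%N j.
Proof.
move=> jn; rewrite {1}/theta.
have e : (n - j = (n - j).-1.+1)%N by lia.
rewrite [X in theta_upto _ _ X]e /= gtn_eqF //.
apply: eq_big_nat => k /andP[k1 k2]; congr (_ * _).
by apply: theta_upto_stable; lia.
Qed.

(* The seed 0 is harmless: the entries are nonnegative. *)
Definition norm_full (R : realType) (M : nat) (v : nat -> R) : R :=
  \big[Num.max/0]_(0 <= i < M.+1) `|v i|.

Definition norm_interior (R : realType) (M : nat) (v : nat -> R) : R :=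
  \big[Num.max/0]_(1 <= i < M) `|v i|.

Definition scheme_solution (R : realType) (alpha rho D l T r : R) (M N : nat)
    (psi : R -> R) (f : R -> R -> R) (u : nat -> nat -> R) : Prop :=
  [/\ forall i n : nat, (1 <= i <= M - 1)%N -> (1 <= n <= N)%N ->
        tempered_L1 alpha rho (time_node T r N) u i n
        = D * delta2 (space_step l M) u i n
          + f (space_node l M i) (time_node T r N n),
      forall n : nat, (0 < n <= N)%N -> u 0%N n = 0 /\ u M n = 0
    & forall i : nat, (i <= M)%N -> u i 0%N = psi (space_node l M i)].

(* Main.v *)
(* At time level n the scheme reads
     d_{n,1} u^n = sum_{0<k<n} (d_{n,k} - d_{n,k+1}) e^{-rho(t_n - t_{n-k})} u^{n-k}
                   + d_{n,n} e^{-rho t_n} u^0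
                   + Gamma(2-alpha) (D delta_x^2 u^n + f^n),
   where d_{n,1} = tau_n^{-alpha} and, x^{1-alpha} being concave, d_{n,k} is
   nonnegative and nonincreasing in k. The exponentials are at most 1, so all
   the weights on earlier levels are nonnegative, with total at most d_{n,1},
   and the discrete maximum principle removes the diffusion term. Induction on n
   then gives the bound: the recursion defining theta is exactly the one
   produced by substituting the bounds for the levels n - k. *)
Require Import Defs.
From mathcomp Require Import all_boot all_order all_algebra.
From mathcomp Require Import all_classical all_reals all_analysis.
From mathcomp Require Import measurable_realfun ring lra zify.
Set Implicit Arguments.
Unset Strict Implicit.
Unset Printing Implicit Defensive.
Import Order.TTheory GRing.Theory Num.Theory.
Import numFieldNormedType.Exports.
Local Open Scope ring_scope.

(** * Concavity of powers *)

Lemma powR_le_tangent1 (R : realType) (p x : R) : 0 < p < 1 -> 0 <= x ->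
  x `^ p <= 1 + p * (x - 1).
Proof.
move=> /andP[p0 p1] x0.
have q0 : 0 < 1 - p by rewrite subr_gt0.
have := @conjugate_powR R (x `^ p) 1 p^-1 (1 - p)^-1 (powR_ge0 _ _) ler01.
rewrite !invr_gt0 !invrK -powRrM mulfV ?gt_eqF// powRr1// powR1 !mulr1.
by move=> /(_ p0 q0); lra.
Qed.

(** The tangent at 1, applied to [x / y] and scaled by [y]^ p[; the quotient]y [^ p / y] is the
    power with exponent p - 1. *)
Lemma powR_le_tangent (R : realType) (p x y : R) : 0 < p < 1 -> 0 <= x -> 0 < y ->
  x `^ p <= y `^ p + p * (y `^ p / y) * (x - y).
Proof.
move=> p01 x0 y0.
have xy0 : 0 <= x / y by rewrite divr_ge0// ltW.
have -> : x `^ p = y `^ p * (x / y) `^ p.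
  rewrite -powRM//; last exact: ltW.
  by rewrite mulrCA mulfV ?gt_eqF// mulr1.
apply: le_trans (ler_wpM2l (powR_ge0 _ _) (powR_le_tangent1 p01 xy0)) _.
rewrite le_eqVlt; apply/orP; left; apply/eqP; field; exact: lt0r_neq0.
Qed.

Lemma powR_slope_decreasing (R : realType) (p a b c : R) : 0 < p < 1 ->
  0 <= a -> a < b -> b < c ->
  (c `^ p - b `^ p) / (c - b) <= (b `^ p - a `^ p) / (b - a).
Proof.
move=> p01 a0 ab bc.
have b0 : 0 < b by exact: le_lt_trans ab.
have c0 : 0 <= c by apply/ltW/(lt_trans b0).
have hc := powR_le_tangent p01 c0 b0.
have ha := powR_le_tangent p01 a0 b0.
(* Both slopes are compared with that of the tangent at [b]. *)
apply: (@le_trans _ _ (p * (b `^ p / b))).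
  by rewrite ler_pdivrMr ?subr_gt0//; lra.
by rewrite ler_pdivlMr ?subr_gt0//; lra.
Qed.

(** * The Gamma factor *)

Lemma Gamma_gt0 (R : realType) (z : R) : 1 < z < 2 -> 0 < Gamma z.
Proof.
move=> /andP[z1 z2]; rewrite /Gamma /Rintegral.
have p01 : 0 < z - 1 < 1 by apply/andP; split; lra.
pose g (x : R) := x `^ (z - 1) * expR (- x).
have g0 x : 0 <= g x by rewrite mulr_ge0 ?powR_ge0 ?expR_ge0.
have mg : measurable_fun setT g.
  apply: measurable_funM; first exact: measurable_powR.
  exact: measurableT_comp.
have half0 : 0 < 2^-1 :> R by rewrite invr_gt0.
(* As [fine] sends +oo to 0, the integral must be shown finite as well as positive. Positivity comes
   from [1, 2], where the integrand is at least exp(-2). *)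
apply: fine_gt0; apply/andP; split.
  apply: (@lt_le_trans _ _ (\int[@lebesgue_measure R]_(x in `[1%R, 2%R]%classic)
    (expR (- 2))%:E)%E).
    rewrite integral_cst//= lebesgue_measure_itv/= lte_fin ltr1n.
    by rewrite -EFinB -EFinM lte_fin mulr_gt0 ?expR_gt0//; lra.
  apply: (@le_trans _ _ (\int[@lebesgue_measure R]_(x in `[1%R, 2%R]%classic)
    (g x)%:E)%E).
    apply: ge0_le_integral => //.
    - by apply/measurable_EFinP; exact: measurable_funTS.
    - move=> x /=; rewrite in_itv/= => /andP[x1 x2].
      rewrite lee_fin -[leLHS]mul1r ler_pM ?expR_ge0//; last first.
        by rewrite ler_expR lerN2.
      have : 1 `^ (z - 1) <= x `^ (z - 1).
        by apply: ge0_ler_powR; rewrite ?nnegrE; lra.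
      by rewrite powR1.
  apply: ge0_subset_integral => //.
  - by apply/measurable_EFinP; exact: measurable_funTS.
  - by move=> x _; rewrite lee_fin; exact: g0.
  - by move=> x /=; rewrite !in_itv/= andbT => /andP[x1 _]; lra.
(* The integrand is dominated by [2 exp(-x/2)], four times an exponential density. *)
apply: (@le_lt_trans _ _ (\int[@lebesgue_measure R]_x
    (4%:E * (exponential_pdf 2^-1 x)%:E))%E); last first.
  rewrite ge0_integralZl//; first by rewrite integral_exponential_pdf// mule1 ltry.
  - by apply/measurable_EFinP; exact: measurable_exponential_pdf.
  - by move=> x _; rewrite lee_fin exponential_pdf_ge0// ltW.
apply: (@le_trans _ _ (\int[@lebesgue_measure R]_(x in `]0%R, +oo[%classic)
    (4%:E * (exponential_pdf 2^-1 x)%:E))%E).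
  apply: ge0_le_integral => //.
  - by move=> x _; rewrite lee_fin; exact: g0.
  - by apply/measurable_EFinP; exact: measurable_funTS.
  - apply: measurable_funTS; apply: emeasurable_funM => //.
    by apply/measurable_EFinP; exact: measurable_exponential_pdf.
  - move=> x /=; rewrite in_itv/= andbT => x0.
    rewrite -EFinM lee_fin exponential_pdfE; last exact: ltW.
    (* The domination is the chain x^(z-1) <= 1 + (z-1)(x-1) <= 1 + x <= 2(1 + x/2) <= 2
       exp(x/2). *)
    have e0 := expR_ge0 (- x).
    have h1 := powR_le_tangent1 p01 (ltW x0).
    have h2 := expR_ge1Dx (x / 2).
    have -> : expR (- 2^-1 * x) = expR (x / 2) * expR (- x).
      by rewrite -expRD; congr expR; lra.
    rewrite !mulrA; apply: (ler_wpM2r e0).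
    have : (z - 1) * (x - 1) <= 1 * x by nra.
    lra.
apply: ge0_subset_integral => //.
- apply: emeasurable_funM => //.
  by apply/measurable_EFinP; exact: measurable_exponential_pdf.
- by move=> x _; rewrite -EFinM lee_fin mulr_ge0// exponential_pdf_ge0// ltW.
Qed.

(** * Summation by parts and maximum norms *)

Lemma abel_sum (R : comPzRingType) (c w : nat -> R) (n : nat) :
  \sum_(0 <= k < n.+1) (w k.+1 - w k) * c (n.+1 - k)%N =
  c 1%N * w n.+1
  - (\sum_(1 <= k < n.+1) (c k - c k.+1) * w (n.+1 - k)%N + c n.+1 * w 0%N).
Proof.
elim: n w => [|n IH] w; first by rewrite big_nat1 big_geq// subn0; ring.
rewrite big_nat_recl// subn0.
(* Since [c] is indexed backwards, removing the term k = 0 leaves the shorter sum for the shifted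
   sequence. *)
have := IH (w \o S) => /= IHw.
under eq_bigr do rewrite subSS.
rewrite {}IHw [in RHS]big_nat_recr//= subSn// subnn.
have -> : \sum_(1 <= k < n.+1) (c k - c k.+1) * w (n.+1 - k).+1 =
          \sum_(1 <= k < n.+1) (c k - c k.+1) * w (n.+2 - k)%N.
  by apply: eq_big_nat => k /andP[_ kn]; rewrite -subSn ?(ltnW kn).
ring.
Qed.

Lemma norm_full_ge (R : realType) (M : nat) (v : nat -> R) (i : nat) :
  (i <= M)%N -> `|v i| <= norm_full M v.
Proof.
move=> iM; apply: (le_bigmax_seq 0 i xpredT (fun j => `|v j|)) => //.
by rewrite mem_index_iota.
Qed.

Lemma norm_interior_ge (R : realType) (M : nat) (v : nat -> R) (i : nat) :
  (1 <= i < M)%N -> `|v i| <= norm_interior M v.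
Proof.
move=> iM; apply: (le_bigmax_seq 0 i xpredT (fun j => `|v j|)) => //.
by rewrite mem_index_iota.
Qed.

Lemma norm_full_le (R : realType) (M : nat) (v : nat -> R) (B : R) :
  0 <= B -> (forall i, (i <= M)%N -> `|v i| <= B) -> norm_full M v <= B.
Proof.
move=> B0 vB; rewrite /norm_full big_seq; apply: bigmax_le => // i.
by rewrite mem_index_iota => /andP[_]; exact: vB.
Qed.

(** * The L1 coefficients and the rearranged operator *)

Lemma L1_coef1 (R : realType) (alpha : R) (t : nat -> R) (n : nat) :
  alpha < 1 -> t n < t n.+1 ->
  tau t n.+1 `^ alpha * L1_coef alpha t n.+1 1 = 1.
Proof.
move=> a1 tn; rewrite /L1_coef subn1/= subrr powR0 ?subr0; last first.
  by rewrite subr_eq0 gt_eqF.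
have tau0 : 0 < tau t n.+1 by rewrite /tau subr_gt0.
rewrite -/(tau t n.+1) mulrA -powRD; last by rewrite (gt_eqF tau0) implybT.
by rewrite addrC subrK powRr1 ?mulfV ?gt_eqF// ltW.
Qed.

Lemma ltn_homo_leq (R : realType) (t : nat -> R) :
  {homo t : m n / (m < n)%N >-> m < n} -> {homo t : m n / (m <= n)%N >-> m <= n}.
Proof. by move=> t_incr m n; rewrite leq_eqVlt => /predU1P[->//|/t_incr/ltW]. Qed.

Lemma L1_coef_ge0 (R : realType) (alpha : R) (t : nat -> R) (n k : nat) :
  0 < alpha < 1 -> {homo t : m n / (m < n)%N >-> m < n} ->
  (0 < k <= n)%N -> 0 <= L1_coef alpha t n k.
Proof.
move=> /andP[a0 a1] t_incr /andP[k0 kn].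
have h1 : t (n - k)%N < t (n - k).+1 by exact: t_incr.
have h2 : t (n - k).+1 <= t n by apply: (ltn_homo_leq t_incr); lia.
rewrite /L1_coef /tau divr_ge0 ?subr_ge0 ?(ltW h1)//.
by apply: ge0_ler_powR; rewrite ?nnegrE; lra.
Qed.

(** The coefficient d_{n,k} is the slope of x^(1-alpha) between t_n - t_{n-k+1} and t_n - t_{n-k};
    raising k moves to the adjacent interval on the right, where a concave function is flatter. *)
Lemma L1_coef_decreasing (R : realType) (alpha : R) (t : nat -> R) (n k : nat) :
  0 < alpha < 1 -> {homo t : m n / (m < n)%N >-> m < n} ->
  (0 < k < n)%N -> L1_coef alpha t n k.+1 <= L1_coef alpha t n k.
Proof.
move=> /andP[a0 a1] t_incr /andP[k0 kn].
have e : (n - k = (n - k.+1).+1)%N by lia.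
have h1 : t (n - k.+1)%N < t (n - k)%N by apply: t_incr; lia.
have h2 : t (n - k)%N < t (n - k).+1 by exact: t_incr.
have h3 : t (n - k).+1 <= t n by apply: (ltn_homo_leq t_incr); lia.
have p01 : 0 < 1 - alpha < 1 by apply/andP; split; lra.
have := @powR_slope_decreasing R (1 - alpha) (t n - t (n - k).+1)
  (t n - t (n - k)%N) (t n - t (n - k.+1)%N) p01.
rewrite subr_ge0 !ltrD2l !ltrN2 => /(_ h3 h2 h1).
rewrite /L1_coef /tau -e e /= -e.
rewrite (_ : t n - t (n - k.+1)%N - _ = t (n - k)%N - t (n - k.+1)%N); last by ring.
by rewrite (_ : t n - t (n - k)%N - _ = t (n - k).+1 - t (n - k)%N); last by ring.
Qed.

(** Summation by parts for the tempered values; the newest one carries the factor exp(0) = 1, so the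
    implicit unknown appears untempered. *)
Lemma tempered_L1E (R : realType) (alpha rho : R) (t : nat -> R)
    (u : nat -> nat -> R) (i n : nat) :
  Gamma (2 - alpha) != 0 ->
  Gamma (2 - alpha) * tempered_L1 alpha rho t u i n.+1 =
  L1_coef alpha t n.+1 1 * u i n.+1
  - (\sum_(1 <= k < n.+1) (L1_coef alpha t n.+1 k - L1_coef alpha t n.+1 k.+1)
        * (expR (- rho * (t n.+1 - t (n.+1 - k)%N)) * u i (n.+1 - k)%N)
     + L1_coef alpha t n.+1 n.+1
        * (expR (- rho * (t n.+1 - t 0%N)) * u i 0%N)).
Proof.
move=> G0; rewrite /tempered_L1 (mulVKf G0).
have := abel_sum (L1_coef alpha t n.+1)
  (fun k => expR (- rho * (t n.+1 - t k)) * u i k) n.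
rewrite subrr mulr0 expR0 mul1r => <-.
apply: eq_big_nat => k /andP[_ kn].
by rewrite /L1_coef subKn ?(ltnW kn)// mulrAC mulrA.
Qed.

(** * Maximum principle and Gronwall inequality *)

Lemma discrete_maximum_principle (R : realType) (M : nat) (v w : nat -> R)
    (c kappa W : R) :
  0 < c -> 0 <= kappa -> 0 <= W -> v 0%N = 0 -> v M = 0 ->
  (forall i, (1 <= i < M)%N ->
    c * v i = kappa * (v i.-1 - 2 * v i + v i.+1) + w i /\ `|w i| <= W) ->
  c * norm_full M v <= W.
Proof.
move=> c0 kappa0 W0 v0 vM vE; set S := norm_full M v.
have S0 : 0 <= S by rewrite (le_trans (normr_ge0 (v 0%N)))// norm_full_ge.
have ck0 : 0 < c + 2 * kappa by lra.
(* Moving the diagonal of the difference to the left gives (c + 2 kappa)|v_i| <= 2 kappa S + W at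
   each interior node. Taking the maximum, the terms 2 kappa S cancel, whatever the size of
   kappa. *)
suff : S <= (2 * kappa * S + W) / (c + 2 * kappa) by rewrite ler_pdivlMr//; lra.
have B0 : 0 <= (2 * kappa * S + W) / (c + 2 * kappa).
  by rewrite divr_ge0 ?(ltW ck0)// addr_ge0// !mulr_ge0.
apply: norm_full_le => // -[_|i iM]; first by rewrite v0 normr0.
have [->|iM'] := eqVneq i.+1 M; first by rewrite vM normr0.
have [|vi wi] := vE i.+1; first by lia.
rewrite ler_pdivlMr// -{1}(gtr0_norm ck0) mulrC -normrM.
have -> : (c + 2 * kappa) * v i.+1 = kappa * (v i + v i.+2) + w i.+1.
  by move: vi => /=; lra.
apply: le_trans (ler_normD _ _) _; apply: lerD => //.
rewrite normrM ger0_norm//; apply: (@le_trans _ _ (kappa * (S + S))); last by lra.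
apply: ler_wpM2l => //; apply: le_trans (ler_normD _ _) _.
by apply: lerD; apply: norm_full_ge; lia.
Qed.

Lemma discrete_gronwall_theta (R : realType) (alpha G : R) (t S F : nat -> R)
    (N : nat) :
  0 < alpha < 1 -> {homo t : m n / (m < n)%N >-> m < n} ->
  (forall n, (n < N)%N ->
    L1_coef alpha t n.+1 1 * S n.+1 <=
    \sum_(1 <= k < n.+1) (L1_coef alpha t n.+1 k - L1_coef alpha t n.+1 k.+1)
        * S (n.+1 - k)%N + L1_coef alpha t n.+1 n.+1 * S 0%N + G * F n.+1) ->
  forall n, (1 <= n <= N)%N ->
  S n <= S 0%N + tau t n `^ alpha * G * \sum_(1 <= j < n.+1) theta alpha t n j * F j.
Proof.
move=> a01 t_incr Srec; have [a0 a1] := andP a01.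
elim/ltn_ind => -[//|n] IH /andP[_ nN].
set d := L1_coef alpha t n.+1.
have tau1 : tau t n.+1 `^ alpha * d 1%N = 1 by apply: L1_coef1 => //; exact: t_incr.
suff H : d 1%N * S n.+1 <= d 1%N * S 0%N +
    G * \sum_(1 <= j < n.+2) theta alpha t n.+1 j * F j.
  have := ler_wpM2l (powR_ge0 (tau t n.+1) alpha) H.
  by rewrite mulrDr !(mulrA _ (d 1%N)) tau1 !mul1r (mulrA _ G).
apply: le_trans (Srec n nN) _; rewrite -/d.
(* The bound j <= n + 1 - k is written as a guard over a range independent of k, so that the two
   sums can be exchanged. *)
have step : \sum_(1 <= k < n.+1) (d k - d k.+1) * S (n.+1 - k)%N <=
  \sum_(1 <= k < n.+1) ((d k - d k.+1) * S 0%N + G *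
     \sum_(1 <= j < n.+1 | (j < (n.+1 - k).+1)%N)
        tau t (n.+1 - k)%N `^ alpha * (d k - d k.+1)
          * theta alpha t (n.+1 - k)%N j * F j).
  apply: ler_sum_nat => k /andP[k1 kn].
  have dk : 0 <= d k - d k.+1 by rewrite subr_ge0 L1_coef_decreasing//; lia.
  apply: le_trans (ler_wpM2l dk (IH (n.+1 - k)%N _ _)) _; [lia|lia|].
  rewrite mulrDr lerD2l -(big_nat_widen _ _ _ xpredT); last by lia.
  rewrite le_eqVlt; apply/orP; left; apply/eqP.
  rewrite !big_distrr/=; apply: eq_bigr => j _; ring.
have -> : \sum_(1 <= j < n.+2) theta alpha t n.+1 j * F j =
  \sum_(1 <= k < n.+1) \sum_(1 <= j < n.+1 | (j < (n.+1 - k).+1)%N)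
        tau t (n.+1 - k)%N `^ alpha * (d k - d k.+1)
          * theta alpha t (n.+1 - k)%N j * F j
  + F n.+1.
  rewrite big_nat_recr//= theta_diag mul1r; congr (_ + _).
  (* After the exchange the guard reads k <= n + 1 - j, which is the summation range in
     [theta_rec]. *)
  rewrite (exchange_big_dep_nat xpredT)//=; apply: eq_big_nat => j /andP[j1 jn].
  rewrite theta_rec// big_distrl/=.
  rewrite (big_nat_widen _ _ n.+1); last by lia.
  by rewrite big_nat_cond [RHS]big_nat_cond; apply: eq_bigl => k /=; lia.
(* Together with the separate weight [d n.+1], the total weight on [S 0] is therefore exactly
   [d 1]. *)
have tel : \sum_(1 <= k < n.+1) (d k - d k.+1) = d 1%N - d n.+1.
  by rewrite -[RHS]opprB -telescope_sumr// -sumrN; apply: eq_bigr => k _; rewrite opprB.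
move: step; rewrite big_split/= -mulr_suml tel -mulr_sumr; lra.
Qed.

(** * Application to the graded mesh *)

Lemma time_node_incr (R : realType) (T r : R) (N : nat) :
  0 < T -> 0 < r -> (0 < N)%N ->
  {homo time_node T r N : m n / (m < n)%N >-> m < n}.
Proof.
move=> T0 r0 N0 m n mn; rewrite /time_node ltr_pM2l//.
have N0' : 0 < N%:R :> R by rewrite ltr0n.
by apply: gt0_ltr_powR; rewrite ?nnegrE ?divr_ge0// ltr_pM2r ?invr_gt0// ltr_nat.
Qed.

Theorem theorem4p1 (R : realType) (alpha rho D l T r : R) (M N : nat)
    (psi : R -> R) (f : R -> R -> R) (u : nat -> nat -> R)
    (alpha_gt0 : 0 < alpha) (alpha_lt1 : alpha < 1) (rho_ge0 : 0 <= rho)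
    (D_gt0 : 0 < D) (l_gt0 : 0 < l) (T_gt0 : 0 < T) (r_ge1 : 1 <= r)
    (M_ge2 : (2 <= M)%N) (N_gt0 : (0 < N)%N)
    (u_sol : scheme_solution alpha rho D l T r M N psi f u)
    (n : nat) (n_range : (1 <= n <= N)%N) :
  norm_full M (fun i => u i n) <=
  norm_full M (fun i => u i 0%N)
  + tau (time_node T r N) n `^ alpha * Gamma (2 - alpha)
    * \sum_(1 <= j < n.+1)
        theta alpha (time_node T r N) n j
        * norm_interior M (fun i => f (space_node l M i) (time_node T r N j)).
Proof.
have [scheme bdry _] := u_sol.
have a01 : 0 < alpha < 1 by rewrite alpha_gt0.
have G0 : 0 < Gamma (2 - alpha) by apply: Gamma_gt0; apply/andP; split; lra.
set G := Gamma (2 - alpha) in G0 *.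
have t_incr := @time_node_incr R T r N T_gt0 (lt_le_trans ltr01 r_ge1) N_gt0.
set t := time_node T r N in t_incr scheme *.
pose S j := norm_full M (fun i => u i j).
pose F j := norm_interior M (fun i => f (space_node l M i) (t j)).
apply: (@discrete_gronwall_theta R alpha G t S F N) => //.
move=> {n_range}{}n nN; set d := L1_coef alpha t n.+1.
have d_ge0 k : (0 < k <= n.+1)%N -> 0 <= d k by exact: L1_coef_ge0.
have dB_ge0 k : (0 < k < n.+1)%N -> 0 <= d k - d k.+1.
  by move=> kn; rewrite subr_ge0; exact: L1_coef_decreasing.
have S_ge0 j : 0 <= S j by exact: bigmax_ge_id.
have F_ge0 j : 0 <= F j by exact: bigmax_ge_id.
(* Strict positivity follows from nonnegativity, because the product of [d 1] with a power of the
   step equals 1. *)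
have d1_gt0 : 0 < d 1%N.
  have /eqP := L1_coef1 alpha_lt1 (t_incr n n.+1 (ltnSn n)).
  rewrite lt0r d_ge0// andbT; apply: contraTneq; rewrite -/d => ->.
  by rewrite mulr0 eq_sym oner_neq0.
have tempered_le k i : (k <= n.+1)%N -> (i <= M)%N ->
    `|expR (- rho * (t n.+1 - t k)) * u i k| <= S k.
  move=> kn iM; rewrite normrM ger0_norm ?expR_ge0// -[leRHS]mul1r.
  apply: ler_pM; rewrite ?expR_ge0 ?norm_full_ge//.
  rewrite -expR0 ler_expR mulNr oppr_le0 mulr_ge0// subr_ge0.
  exact: (ltn_homo_leq t_incr).
have dn : 0 <= d n.+1 by rewrite d_ge0 ?ltnSn.
have [u0 uM] := bdry n.+1 nN.
(* All history and source terms go into the right-hand side [w]; the diffusion, multiplied by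
   Gamma(2 - alpha), has kappa = Gamma(2 - alpha) D / h^2. *)
apply: (@discrete_maximum_principle R M (fun i => u i n.+1)
  (fun i => \sum_(1 <= k < n.+1) (d k - d k.+1)
        * (expR (- rho * (t n.+1 - t (n.+1 - k)%N)) * u i (n.+1 - k)%N)
     + d n.+1 * (expR (- rho * (t n.+1 - t 0%N)) * u i 0%N)
     + G * f (space_node l M i) (t n.+1))
  (d 1%N) (G * (D / space_step l M ^+ 2))) => //.
- by rewrite !mulr_ge0 ?invr_ge0 ?sqr_ge0 ?ltW.
- rewrite addr_ge0 ?(mulr_ge0 (ltW G0))// addr_ge0 ?(mulr_ge0 dn)//.
  by rewrite big_nat; apply: sumr_ge0 => k /dB_ge0 dk; exact: mulr_ge0.
move=> i iM; split.
  have := scheme i n.+1 _ nN; rewrite -/t => /(_ _) e.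
  have := tempered_L1E rho t u i n (lt0r_neq0 G0).
  rewrite e; last by lia.
  by rewrite /delta2 -/G -/d; lra.
apply: le_trans (ler_normD _ _) _; apply: lerD; last first.
  by rewrite normrM gtr0_norm// ler_pM2l// norm_interior_ge.
apply: le_trans (ler_normD _ _) _; apply: lerD; last first.
  by rewrite normrM ger0_norm// ler_wpM2l// tempered_le//; lia.
apply: le_trans (ler_norm_sum _ _ _) _; apply: ler_sum_nat => k kn.
by rewrite normrM ger0_norm ?dB_ge0// ler_wpM2l ?dB_ge0// tempered_le//; lia.
Qed.
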